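(* Consider the IoT network formation game described in the context, with node set $P$, set of internet-connected nodes $G_I\subseteq P$, set of non-internet-connected nodes $G_S=P\setminus G_I$, and weight $\Gamma\ge 1$. For distinct $p_i,p_k\in G_I$ let $L_i(k)$ be the maximum cost to $p_i$ of establishing a link with $p_k$ (the maximum being over the admissible interface pairs for a link between them, of which there is at least one). If $L_i(k)<\Gamma-1$ for all distinct $p_i,p_k\in G_I$, then in every pairwise stable topology $G$ the nodes of $G_I$ form a clique, i.e. every two distinct nodes of $G_I$ are directly linked in $G$.
   Context: Nodes and links. $P=\{p_1,\dots,p_N\}$ is a finite set of nodes (players), $N\ge 2$, partitioned into $G_I$ (internet-connected, ''IC'' nodes) and $G_S=P\setminus G_I$ (non-IC nodes). Each node $p_i$ has a finite set $R_i$ of radio interfaces. For each pair of distinct nodes $p_i,p_j$ there is a (possibly empty) set of admissible interface pairs $(r_i,r_j)\in R_i\times R_j$ over which a link between them can be formed. A topology $G$ is an undirected simple graph on $P$ in which each edge $ij$ is labelled by one admissible interface pair $(r_i,r_j)$. $\deg(i)$ is the number of links of $p_i$ in $G$ and $h(i,j)$ is the hop distance (length of a shortest path) in $G$. Link costs. A link of $p_i$ on interface $r$ costs $p_i$ the positive real number $\alpha\,\rho_i\,\sigma_{ir}/\beta_{ir}$, where $\alpha>0$ is a constant, $\rho_i>0$ is the relative importance to $p_i$ of preserving energy, $\sigma_{ir}>0$ is the power transmitted by $p_i$ on this link, and $\beta_{ir}=b_{ir}/b_i^{Min}>0$ is the ratio of the available bandwidth to the required bandwidth. The cost to $p_i$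 depends on the link (including its interface pair) but not on the other links present, and the costs to the two endpoints may differ. Node cost. For a topology $G$ the cost of $p_i$ is $$C(i,G)=\sum_{\text{links } e \text{ of } p_i \text{ in } G}(\text{cost of } e \text{ to } p_i)+\Gamma\sum_{j\in G_I}h(i,j)+\sum_{k\in G_S}h(i,k)+B_i,$$ where $\Gamma\ge 1$ is a constant and $$B_i=\frac{1/\deg(i)}{\sum_{j \text{ linked to } i \text{ in } G} 1/\deg(j)}$$ is the bridging coefficient of $p_i$ in $G$. Hop limit. There is a fixed bound $h_{Max}$ on the number of hops between each pair of nodes: the topologies under consideration satisfy $h(i,j)\le h_{Max}$ for all $i,j$ (in particular they are connected). If a deviation yields a graph in which some node is not reachable from $p_i$ within $h_{Max}$ hops, then $p_i$'s cost there is $+\infty$. Pairwise stability. $G-ij$ denotes $G$ with link $ij$ removed; $G+ij$ denotes $G$ with link $ij$ added, using some admissible interface pair. $G$ is pairwise stable if (1) for every node $i$ and every link $ij\in G$, $C(i,G)\le C(i,G-ij)$; and (2) for all $ij\notin G$ (and every admissible interface pair for the new link), if $C(i,G+ij)<C(i,G)$ then $C(j,G+ij)>C(j,G)$. *)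

(* Defs.v *)
From mathcomp Require Import all_boot all_order all_algebra.
From mathcomp Require Import reals constructive_ereal.

Set Implicit Arguments.
Unset Strict Implicit.
Unset Printing Implicit Defensive.

Import Order.TTheory GRing.Theory Num.Theory.
Local Open Scope ring_scope.

(* P is the set of nodes and I a set containing all radio interfaces; R_i is
   [iface i].  An interface pair is oriented: the first component of
   [p \in adm i j] is the interface of i, the second that of j.
   [sigma i j p] is the power transmitted by i on the link with j using p. *)
Record iot_game (R : realType) (P I : finType) := IotGame {
  GI : {set P};
  iface : P -> {set I};
  adm : P -> P -> {set I * I};
  alpha : R;
  rho : P -> R;
  sigma : P -> P -> I * I -> R;
  bandwidth : P -> I -> R;
  bandwidth_min : P -> R;
  Gamma : R;
  hop_max : nat;
  adm_iface : forall i j p, i != j -> p \in adm i j ->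
    p.1 \in iface i /\ p.2 \in iface j;
  adm_sym : forall i j r s, i != j ->
    ((r, s) \in adm i j) = ((s, r) \in adm j i);
  alpha_gt0 : 0 < alpha;
  rho_gt0 : forall i, 0 < rho i;
  sigma_gt0 : forall i j p, i != j -> p \in adm i j -> 0 < sigma i j p;
  beta_gt0 : forall i r, r \in iface i -> 0 < bandwidth i r / bandwidth_min i;
  Gamma_ge1 : 1 <= Gamma
}.

(* [G i j = Some (r, s)]: the link ij is present, on interface r of i and
   interface s of j; [G i j = None]: there is no link ij. *)
Definition labelling (P I : finType) := P -> P -> option (I * I).

Section Graph.
Variables (P I : finType).
Implicit Types (G : labelling P I) (i j : P).

Definition linked G : rel P := fun i j => isSome (G i j).

Definition deg G i : nat := #|[set j | linked G i j]|.

Definition walk G (n : nat) i j : bool :=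
  [exists s : n.-tuple P, path (linked G) i s && (last i s == j)].

(* The least n such that a walk of length n joins i to j.  If there is one then
   n < #|P|, so searching below #|P| is enough; the result is the junk value
   #|P| when j is not reachable from i. *)
Definition hop G i j : nat := find (fun n => walk G n i j) (iota 0 #|P|).

Definition within_hops (h : nat) G i j : bool :=
  connect (linked G) i j && (hop G i j <= h)%N.

Definition del_link G i j : labelling P I := fun x y =>
  if ((x, y) == (i, j)) || ((x, y) == (j, i)) then None else G x y.

Definition add_link G i j (p : I * I) : labelling P I := fun x y =>
  if (x, y) == (i, j) then Some p
  else if (x, y) == (j, i) then Some (p.2, p.1)
  else G x y.

End Graph.

Section Game.
Variables (R : realType) (P I : finType) (g : iot_game R P I).
Implicit Types (G : labelling P I) (i j k : P).

Definition GS : {set P} := ~: GI g.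

Definition topology G : Prop :=
  [/\ forall i, G i i = None,
      forall i j r s, G i j = Some (r, s) -> G j i = Some (s, r)
    & forall i j p, G i j = Some p -> p \in adm g i j].

Definition hop_bounded G : Prop := forall i j, within_hops (hop_max g) G i j.

Definition beta i (r : I) : R := bandwidth g i r / bandwidth_min g i.

Definition link_cost i j (p : I * I) : R :=
  alpha g * rho g i * sigma g i j p / beta i p.1.

(* The costs of admissible pairs are positive, so for a nonempty [adm g i k]
   the default value 0 does not affect the maximum. *)
Definition max_link_cost i k : R :=
  \big[Num.max/0]_(p in adm g i k) link_cost i k p.

Definition bridging G i : R :=
  (deg G i)%:R^-1 / \sum_(j | linked G i j) (deg G j)%:R^-1.

Definition finite_cost G i : R :=
  \sum_j oapp (link_cost i j) 0 (G i j)
  + Gamma g * \sum_(j in GI g) (hop G i j)%:R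
  + \sum_(k in GS) (hop G i k)%:R
  + bridging G i.

Definition cost i G : \bar R :=
  if [forall j, within_hops (hop_max g) G i j] then (finite_cost G i)%:E
  else +oo%E.

Definition pairwise_stable G : Prop :=
  (forall i j, linked G i j -> (cost i G <= cost i (del_link G i j))%E) /\
  (forall i j p, i != j -> ~~ linked G i j -> p \in adm g i j ->
     (cost i (add_link G i j p) < cost i G)%E ->
     (cost j G < cost j (add_link G i j p))%E).

End Game.

(* Main.v *)
(* If i and k are internet-connected but not linked, then h(i,k) >= 2, and the
   new link ik lowers the cost of i: the link costs less than Gamma, the hop
   term for k drops by at least Gamma, no other distance grows, and the bridging
   coefficient does not grow, because deg(i) increases while the neighbours of i
   keep their degrees and are joined by k.  The same holds for k, so both
   endpoints gain from the link, which pairwise stability forbids. *)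
Require Import Defs.
From mathcomp Require Import all_boot all_order all_algebra.
From mathcomp Require Import reals constructive_ereal.
From mathcomp Require Import lra.
Import Order.TTheory GRing.Theory Num.Theory.
Local Open Scope ring_scope.

Set Implicit Arguments.
Unset Strict Implicit.

(** Each walk of [G] is a walk of [G'] of the same length, so the search over lengths stops no
    later; this also covers the junk value. *)
Lemma hop_mono (P I : finType) (G G' : labelling P I) (i j : P) :
  subrel (linked G) (linked G') -> (hop G' i j <= hop G i j)%N.
Proof.
move=> sGG'; apply: sub_find => n /existsP[s /andP[ps ls]].
by apply/existsP; exists s; rewrite ls (sub_path sGG' ps).
Qed.

Lemma within_hops_mono (P I : finType) (h : nat) (G G' : labelling P I)
    (i j : P) :
  subrel (linked G) (linked G') -> within_hops h G i j -> within_hops h G' i j.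
Proof.
move=> sGG' /andP[cG hG]; apply/andP; split.
  by apply: connect_sub cG => x y /sGG'; apply: connect1.
exact: leq_trans (hop_mono _ _ sGG') hG.
Qed.

Lemma walk0E (P I : finType) (G : labelling P I) (i j : P) :
  walk G 0 i j = (i == j).
Proof.
apply/existsP/idP => [[s]|ij]; first by rewrite (tuple0 s).
by exists [tuple].
Qed.

Lemma walk1E (P I : finType) (G : labelling P I) (i j : P) :
  walk G 1 i j = linked G i j.
Proof.
apply/existsP/idP => [[s]|ij]; last by exists [tuple j]; rewrite /= ij eqxx.
by case/tupleP: s => x s; rewrite (tuple0 s) /= andbT => /andP[? /eqP<-].
Qed.

(** With at least two nodes the searched lengths begin with 0 and 1, so these two tests settle the
    bound here and in the next lemma. *)
Lemma hop_linked (P I : finType) (G : labelling P I) (i j : P) :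
  (1 < #|P|)%N -> linked G i j -> (hop G i j <= 1)%N.
Proof.
rewrite /hop; case: #|P| => [|[|n]] //= _ Gij.
by rewrite walk1E Gij; case: ifP.
Qed.

Lemma hop_not_linked (P I : finType) (G : labelling P I) (i j : P) :
  (1 < #|P|)%N -> i != j -> ~~ linked G i j -> (2 <= hop G i j)%N.
Proof.
rewrite /hop; case: #|P| => [|[|n]] //= _ ij Gij.
by rewrite walk0E walk1E (negbTE ij) (negbTE Gij).
Qed.

Lemma deg_gt0 (P I : finType) (G : labelling P I) (i j : P) :
  linked G i j -> (0 < deg G i)%N.
Proof. by move=> Gij; apply/card_gt0P; exists j; rewrite inE. Qed.

Lemma linked_exists (P I : finType) (G : labelling P I) (i k : P) :
  i != k -> connect (linked G) i k -> exists j, linked G i j.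
Proof.
move=> ik /connectP[[|j s] /= ps ks]; first by rewrite ks eqxx in ik.
by exists j; case/andP: ps.
Qed.

(* Only the presence of ki is recorded, since the cost of i ignores its label;
   both orientations of a new link then fit this description. *)
Definition extends_by_link (P I : finType) (G G' : labelling P I) (i k : P)
    (p : I * I) : Prop :=
  [/\ G' i k = Some p, linked G' k i
    & forall x y, (x, y) != (i, k) -> (x, y) != (k, i) -> G' x y = G x y].

Lemma add_linkP (P I : finType) (G : labelling P I) (i k : P) (p : I * I) :
  i != k -> extends_by_link G (add_link G i k p) i k p.
Proof.
move=> ik; rewrite /extends_by_link /linked /add_link !eqxx; split=> //.
  by rewrite !xpair_eqE eq_sym (negbTE ik).
by move=> x y /negbTE-> /negbTE->.
Qed.

(** The same new topology seen from [k], so that one cost estimate serves both endpoints. *)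
Lemma add_link_swapP (P I : finType) (G : labelling P I) (i k : P)
    (p : I * I) :
  i != k -> extends_by_link G (add_link G i k p) k i (p.2, p.1).
Proof.
move=> ik; rewrite /extends_by_link /linked /add_link !eqxx; split=> //.
  by rewrite !xpair_eqE eq_sym (negbTE ik).
by move=> x y /negbTE-> /negbTE->.
Qed.

Lemma extends_sub (P I : finType) (G G' : labelling P I) (i k : P)
    (p : I * I) :
  extends_by_link G G' i k p -> subrel (linked G) (linked G').
Proof.
move=> [Gik Gki GE] x y.
have [[-> ->] _|ne1] := eqVneq (x, y) (i, k); first by rewrite /linked Gik.
have [[-> ->] //|ne2] := eqVneq (x, y) (k, i).
by rewrite /linked GE.
Qed.

Lemma extends_other (P I : finType) (G G' : labelling P I) (i k : P)
    (p : I * I) (x y : P) :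
  extends_by_link G G' i k p -> x != i -> x != k -> G' x y = G x y.
Proof.
by move=> [_ _ GE] xi xk; apply: GE; rewrite xpair_eqE ?(negbTE xi) ?(negbTE xk).
Qed.

Lemma extends_at (P I : finType) (G G' : labelling P I) (i k : P)
    (p : I * I) (y : P) :
  i != k -> extends_by_link G G' i k p -> y != k -> G' i y = G i y.
Proof.
move=> ik [_ _ GE] yk; apply: GE; rewrite xpair_eqE ?(negbTE yk) ?andbF //.
by rewrite (negbTE ik).
Qed.

(** The neighbour [j] keeps [i] from being isolated in [G]; otherwise division by zero would make
    its old bridging coefficient 0 and the inequality would fail. *)
Lemma bridging_extends (R : realType) (P I : finType) (G G' : labelling P I)
    (i k j : P) (p : I * I) :
  (forall x y, linked G x y -> linked G y x) -> (forall x, ~~ linked G x x) ->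
  i != k -> ~~ linked G i k -> linked G i j ->
  extends_by_link G G' i k p -> bridging R G' i <= bridging R G i.
Proof.
move=> symG irrG ik nGik Gij ext; have sGG' := extends_sub ext.
have Gik : linked G' i k by case: ext => Gik _ _; rewrite /linked Gik.
have di : (0 < deg G i)%N := deg_gt0 Gij.
have S_gt0 : 0 < \sum_(x | linked G i x) (deg G x)%:R^-1 :> R.
  rewrite (bigD1 j) //= ltr_wpDr ?sumr_ge0 // => [x _|].
    by rewrite invr_ge0 ler0n.
  by rewrite invr_gt0 ltr0n; apply: deg_gt0 (symG _ _ Gij).
have S_le : \sum_(x | linked G i x) (deg G x)%:R^-1
    <= \sum_(x | linked G' i x) (deg G' x)%:R^-1 :> R.
  rewrite [leRHS](bigD1 k) //= ler_wpDl ?invr_ge0 ?ler0n //.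
  (* Once the nonnegative term of [k] is dropped, the two sums agree term by term: an old neighbour
     of [i] is neither [i] nor [k], so its links are untouched. *)
  rewrite le_eqVlt; apply/orP; left; apply/eqP; apply: eq_big => x.
    have [->|xk] := eqVneq x k; first by rewrite (negbTE nGik) andbF.
    by rewrite andbT /linked (extends_at ik ext xk).
  move=> Gix; have xi : x != i by apply: contraTneq Gix => ->.
  have xk : x != k by apply: contraTneq Gix => ->.
  congr (_%:R^-1); apply: eq_card => y.
  by rewrite !inE /linked (extends_other _ ext xi xk).
rewrite /bridging ler_pM ?invr_ge0 ?ler0n ?(ltW (lt_le_trans S_gt0 S_le)) //.
  rewrite lef_pV2 ?posrE ?ltr0n ?(deg_gt0 Gik) // ler_nat.
  by apply/subset_leq_card/subsetP => x; rewrite !inE; apply: sGG'.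
by rewrite lef_pV2 ?posrE ?(lt_le_trans S_gt0 S_le).
Qed.

Lemma cost_extends (R : realType) (P I : finType) (g : iot_game R P I)
    (G G' : labelling P I) (i k : P) (p : I * I) :
  (1 < #|P|)%N -> topology g G -> hop_bounded g G ->
  i != k -> k \in GI g -> ~~ linked G i k ->
  extends_by_link G G' i k p -> link_cost g i k p < Gamma g ->
  (cost g i G' < cost g i G)%E.
Proof.
move=> cardP [irrG symG _] hopG ik kI nGik ext cheap.
have sGG' := extends_sub ext.
have hb : forall j, within_hops (hop_max g) G i j by move=> j; apply: hopG.
rewrite /cost (introT forallP hb).
have hb' : [forall j, within_hops (hop_max g) G' i j].
  by apply/forallP => j; apply: within_hops_mono (hb j).
rewrite hb' lte_fin /finite_cost.
(* The hop bound connects [i] to [k], so [i] already has a neighbour. *)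
have [j Gij] : exists j, linked G i j.
  by case/andP: (hopG i k) => + _; apply: linked_exists.
have bridge : bridging R G' i <= bridging R G i.
  apply: (bridging_extends R _ _ ik nGik Gij ext).
    move=> x y; rewrite /linked; case E: (G x y) => [[r s]|] // _.
    by rewrite (symG _ _ _ _ E).
  by move=> x; rewrite /linked irrG.
have Gik : G' i k = Some p by case: ext.
have links : \sum_j oapp (link_cost g i j) 0 (G' i j)
    = link_cost g i k p + \sum_j oapp (link_cost g i j) 0 (G i j).
  rewrite (bigD1 k) //= [in RHS](bigD1 k) //= Gik.
  move: nGik; rewrite /linked; case: (G i k) => //= _; rewrite add0r.
  congr (_ + _); apply: eq_bigr => y yk.
  by rewrite (extends_at ik ext yk).
have hopS : \sum_(x in GS g) (hop G' i x)%:R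
    <= \sum_(x in GS g) (hop G i x)%:R :> R.
  by apply: ler_sum => x _; rewrite ler_nat hop_mono.
(* The gain of 1 comes from the term of [k], which falls from at least 2 to at most 1. *)
have hopI : \sum_(x in GI g) (hop G' i x)%:R + 1
    <= \sum_(x in GI g) (hop G i x)%:R :> R.
  rewrite (bigD1 k) //= [leRHS](bigD1 k) //= addrAC lerD //.
    rewrite natr1 ler_nat (leq_trans _ (hop_not_linked cardP ik nGik)) //.
    by rewrite ltnS hop_linked // /linked Gik.
  by apply: ler_sum => x _; rewrite ler_nat hop_mono.
have Gamma0 : 0 <= Gamma g by rewrite (le_trans ler01) ?Gamma_ge1.
(* Weighted by [Gamma g], the gain of one hop strictly exceeds the price of the link. *)
have := ler_wpM2l Gamma0 hopI; rewrite mulrDr mulr1 links; lra.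
Qed.

Unset Implicit Arguments.

Theorem theorem1 (R : realType) (P I : finType) (g : iot_game R P I)
    (card_P : (2 <= #|P|)%N)
    (adm_GI : forall i k : P, i \in GI g -> k \in GI g -> i != k ->
       exists p : I * I, p \in adm g i k)
    (cheap_GI : forall i k : P, i \in GI g -> k \in GI g -> i != k ->
       max_link_cost g i k < Gamma g - 1)
    (G : labelling P I) (topG : topology g G) (hopG : hop_bounded g G)
    (stableG : pairwise_stable g G) :
  forall i k : P, i \in GI g -> k \in GI g -> i != k -> linked G i k.
Proof.
move=> i k iI kI ik; apply/negPn/negP => nGik.
have nGki : ~~ linked G k i.
  apply: contra nGik; case: topG => _ symG _.
  by rewrite /linked; case E: (G k i) => [[r s]|] // _; rewrite (symG _ _ _ _ E).
have cheap x y q : x \in GI g -> y \in GI g -> x != y -> q \in adm g x y ->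
    link_cost g x y q < Gamma g.
  move=> xI yI xy qa; have := cheap_GI x y xI yI xy.
  have : link_cost g x y q <= max_link_cost g x y by exact: le_bigmax_cond.
  lra.
have ki : k != i by rewrite eq_sym.
have [p pa] := adm_GI i k iI kI ik.
have qa : (p.2, p.1) \in adm g k i by rewrite -adm_sym // -surjective_pairing.
have [_ /(_ i k p ik nGik pa)] := stableG.
have lt_i := cost_extends card_P topG hopG ik kI nGik
  (add_linkP _ _ ik) (cheap _ _ _ iI kI ik pa).
have lt_k := cost_extends card_P topG hopG ki iI nGki
  (add_link_swapP _ _ ik) (cheap _ _ _ kI iI ki qa).
(* Since [i] gains, stability makes [k] lose strictly, against [lt_k]. *)
by move=> /(_ lt_i) /(lt_trans lt_k); rewrite ltxx.
Qed.
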